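(* Let $f:\mathbb{R}^n\to\mathbb{R}$ be convex and continuously differentiable on $\mathcal{X}$ (written in the paper as $\nabla^2 f(x)\succeq 0$ for all $x\in\mathcal{X}$), with $\nabla f$ Lipschitz continuous on $\mathcal{X}$ with constant $L<\infty$. Let $\mathcal{X}\subset\mathbb{R}^n$ be nonempty, convex and compact, and suppose there exists a primal-dual pair $(x^*,\lambda^* )$ with $x^*\in\mathcal{X}$, $c(x^* )=0$ and $\frac1\eta(\mathrm{proj}_{\mathcal{X}}(x^*-\eta\nabla_x\ell(x^*,\lambda^* ))-x^* )=0$ (for $\eta>0$). Suppose there are constants $\omega_1,\omega_2\ge 0$ with $\mathbb{E}_\zeta[\|\nabla F(x,\zeta)-\nabla f(x)\|^2]\le \omega_1\|\nabla f(x)\|^2+\omega_2$ for all $x\in\mathcal{X}$. For any $x_{-1}$, $\lambda_0$ and $\alpha>0$, let $\{(x_k,\lambda_k)\}$ be the sequence of primal-dual iterates generated by the inexact augmented Lagrangian method. Let $\theta_e\in[0,1)$ and $\tau_k\ge 0$ (with $\tau_0>0$) be such that $\tau_0^{-1}\sum_{k=0}^\infty\tau_k=a_\infty<\infty$. Suppose that any of the following three statements holds at each iteration $k\in\mathbb{N}$ (where $x_k^*$ denotes a minimizer of $\mathcal{L}(\cdot,\lambda_k;\alpha)$ over $\mathcal{X}$): (a) $\mathbb{E}_k[\|c(x_k^* )-c(x_k)\|^2]\le\theta_e^2\|c(x_k^* )\|^2+\tau_k$; (b) $\mathbb{E}_k[\mathcal{L}(x_k,\lambda_k;\alpha)-\mathcal{L}(x_k^*,\lambda_k;\alpha)]\le\frac{\alpha\theta_e^2\|c(x_k^*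 )\|^2}{2}+\frac{\alpha\tau_k}{2}$; (c) the augmented Lagrangian is $\mu$-strongly convex in $x$, i.e. $\nabla^2_{xx}\mathcal{L}(x,\lambda;\alpha)\succeq\mu I$ for all $x\in\mathcal{X}$, $\lambda\in\mathbb{R}^m$, and $\mathbb{E}_k[\|R(x_k,\lambda_k;\alpha,\bar\eta)\|^2]\le\tilde\theta_e^2\|c(x_k^* )\|^2+\tilde\tau_k$, where $\bar\eta\in(0,\frac{1}{L+\alpha\|A\|^2})$ is the step size of the method, $\tilde\theta_e\in[0,1)$, $\tilde\tau_k\ge0$, $\tilde\theta_e\le\frac{\mu\theta_e}{2\|A\|}$ and $\tilde\tau_k\le\frac{\mu^2\tau_k}{4\|A\|^2}$. Then $\lim_{k\to\infty}\mathbb{E}[\|c(x_k)\|^2]=0$. Moreover, for any positive integer $K$, $$\min_{0\le k\le K-1}\mathbb{E}[\|c(x_k)\|^2]\le\frac{4(1+\theta_e^2)}{\alpha(1-\theta_e^2)K}\,[q_\alpha(\lambda_0)-q^*]+\frac{4}{1-\theta_e^2}\,\frac{\tau_0a_\infty}{K},$$ where $q^*=\min_\lambda q_\alpha(\lambda)>-\infty$. In addition, if either (b) or (c) is satisfied, then $$\lim_{k\to\infty}\mathbb{E}\left[\left\|\frac{\mathrm{proj}_{\mathcal{X}}(x_k-\eta\nabla_x\ell(x_k,\lambda_{k+1}))-x_k}{\eta}\right\|^2\right]=0$$ for every $0<\eta<\frac{1}{L+\alpha\|A\|^2}$.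
   Context: Problem: minimize $f(x)=\mathbb{E}_\zeta[F(x,\zeta)]$ over $x\in\mathcal{X}\subset\mathbb{R}^n$ subject to $c(x)=0$, where $F(\cdot,\zeta):\mathbb{R}^n\to\mathbb{R}$ are smooth random functions and $c(x)=Ax-b$ with $A\in\mathbb{R}^{m\times n}$, $b\in\mathbb{R}^m$. $\|\cdot\|$ is the $\ell_2$ vector norm or the induced matrix norm; $\mathbb{N}=\{0,1,2,\dots\}$; $\mathrm{proj}_{\mathcal{X}}$ is Euclidean projection onto $\mathcal{X}$. Lagrangian: $\ell(x,\lambda)=f(x)-\langle\lambda,c(x)\rangle$, so $\nabla_x\ell(x,\lambda)=\nabla f(x)-A^T\lambda$. Augmented Lagrangian: $\mathcal{L}(x,\lambda;\alpha)=f(x)-\langle\lambda,c(x)\rangle+\frac{\alpha}{2}\|c(x)\|^2$. Negative dual function: $q(\lambda)=-\min_{x\in\mathcal{X}}\ell(x,\lambda)$; its Moreau envelope: $q_\alpha(u)=\min_\lambda[q(\lambda)+\frac{1}{2\alpha}\|\lambda-u\|^2]$. Projected (reduced) gradient: $R(x,\lambda;\alpha,\eta)=\frac{1}{\eta}\big(\mathrm{proj}_{\mathcal{X}}(x-\eta\nabla_x\mathcal{L}(x,\lambda;\alpha))-x\big)$. Inexact augmented Lagrangian method: given (deterministic) $x_{-1}\in\mathbb{R}^n$, $\lambda_0\in\mathbb{R}^m$, $\alpha>0$; for $k=0,1,\dots$, a stochastic subproblem solver started at $x_{k-1}$ produces a random approximate minimizer $x_k\in\mathcal{X}$ of $\min_{x\in\mathcal{X}}\mathcal{L}(x,\lambda_k;\alpha)$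 satisfying prescribed inexactness conditions, and then $\lambda_{k+1}=\lambda_k-\alpha c(x_k)$. $\mathbb{E}_k$ denotes conditional expectation given all randomness of outer iterations $0,\dots,k-1$ (so $x_{k-1}$ and $\lambda_k$ are known); $\mathbb{E}$ is the full expectation. *)

(* Defs.v *)
From HB Require Import structures.
From mathcomp Require Import all_boot all_order all_algebra.
From mathcomp Require Import all_classical all_reals all_analysis.

Set Implicit Arguments.
Unset Strict Implicit.
Unset Printing Implicit Defensive.

Import Order.TTheory GRing.Theory Num.Theory.
Import numFieldNormedType.Exports.

Local Open Scope classical_set_scope.
Local Open Scope ring_scope.

Section Euclidean.
Variable R : realType.

Definition dotv n (u v : 'cV[R]_n) : R := \sum_i u i 0 * v i 0.

(* The library norm on matrices is the max norm (it induces the same topology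
   as the Euclidean norm). *)
Definition norm2 n (u : 'cV[R]_n) : R := Num.sqrt (dotv u u).

Definition opnorm m n (A : 'M[R]_(m, n)) : R :=
  sup [set norm2 (A *m x) | x in [set x : 'cV[R]_n | norm2 x <= 1]].

(* To be used only where [f] is differentiable. *)
Definition grad n (f : 'cV[R]_n -> R) (x : 'cV[R]_n) : 'cV[R]_n :=
  \col_i 'D_(delta_mx i 0) (f : 'cV[R]_n -> R^o) x.

Definition is_argmin (T : Type) (X : set T) (g : T -> R) (x : T) : Prop :=
  X x /\ forall y, X y -> g x <= g y.

Definition is_minimum (S : set R) (v : R) : Prop := S v /\ lbound S v.

(* The Euclidean projection is unique for X nonempty, closed and convex; the
   default value 0 is never used in that case. *)
Definition eproj n (X : set 'cV[R]_n) (z : 'cV[R]_n) : 'cV[R]_n :=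
  xget 0 [set p | is_argmin X (fun y => norm2 (y - z)) p].

Definition projgrad n (X : set 'cV[R]_n) (g : 'cV[R]_n) (eta : R)
    (x : 'cV[R]_n) : 'cV[R]_n :=
  eta^-1 *: (eproj X (x - eta *: g) - x).

Definition lipschitz2_on n (X : set 'cV[R]_n) (L : R)
    (g : 'cV[R]_n -> 'cV[R]_n) : Prop :=
  forall x y, X x -> X y -> norm2 (g x - g y) <= L * norm2 (x - y).

Definition strongly_convex_on n (X : set 'cV[R]_n) (mu : R)
    (g : 'cV[R]_n -> R) : Prop :=
  forall x y t, X x -> X y -> 0 <= t <= 1 ->
    g (t *: x + (1 - t) *: y) <=
      t * g x + (1 - t) * g y - mu / 2 * (t * (1 - t)) * norm2 (x - y) ^+ 2.

End Euclidean.

Section Lagrangians.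
Variables (R : realType) (m n : nat).
Variables (f : 'cV[R]_n -> R) (A : 'M[R]_(m, n)) (b : 'cV[R]_m).

Definition constr (x : 'cV[R]_n) : 'cV[R]_m := A *m x - b.

Definition lagr (x : 'cV[R]_n) (l : 'cV[R]_m) : R :=
  f x - dotv l (constr x).

Definition auglagr (alpha : R) (x : 'cV[R]_n) (l : 'cV[R]_m) : R :=
  f x - dotv l (constr x) + alpha / 2 * norm2 (constr x) ^+ 2.

(* [inf] stands for min in the next two definitions: the infimum over X is
   attained by compactness, and the second one because the objective is
   strongly convex, lower semicontinuous and bounded below. *)
Definition negdual (X : set 'cV[R]_n) (l : 'cV[R]_m) : R :=
  - inf [set lagr x l | x in X].

Definition negdual_env (X : set 'cV[R]_n) (alpha : R) (u : 'cV[R]_m) : R :=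
  inf (range (fun l => negdual X l + (2 * alpha)^-1 * norm2 (l - u) ^+ 2)).

(* The reduced gradient R(x, l; alpha, eta). *)
Definition redgrad (X : set 'cV[R]_n) (alpha eta : R)
    (x : 'cV[R]_n) (l : 'cV[R]_m) : 'cV[R]_n :=
  projgrad X (grad (auglagr alpha ^~ l) x) eta x.

(* Its analogue for the ordinary Lagrangian. *)
Definition redgrad0 (X : set 'cV[R]_n) (eta : R)
    (x : 'cV[R]_n) (l : 'cV[R]_m) : 'cV[R]_n :=
  projgrad X (grad (lagr ^~ l) x) eta x.

End Lagrangians.

Section Method.
Variables (R : realType) (m n : nat) (A : 'M[R]_(m, n)) (b : 'cV[R]_m).
Variables (alpha : R) (xinit : 'cV[R]_n) (l0 : 'cV[R]_m).
Variables (T Xi : Type).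
(* [xi k] is the randomness drawn during outer iteration k, and [solver k x l s]
   is the output, for the draw s, of the subproblem solver started at x for the
   multiplier l. *)
Variables (solver : nat -> 'cV[R]_n -> 'cV[R]_m -> Xi -> 'cV[R]_n).
Variable xi : nat -> T -> Xi.

(* The pair (x_{k-1}, lambda_k), with x_{-1} = xinit. *)
Fixpoint ialm_state (k : nat) (w : T) : 'cV[R]_n * 'cV[R]_m :=
  if k is j.+1 then
    let s := ialm_state j w in
    let x := solver j s.1 s.2 (xi j w) in
    (x, s.2 - alpha *: constr A b x)
  else (xinit, l0).

Definition ialm_x (k : nat) (w : T) : 'cV[R]_n := (ialm_state k.+1 w).1.
Definition ialm_l (k : nat) (w : T) : 'cV[R]_m := (ialm_state k w).2.

End Method.

Section ConditionalExpectation.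
Context d (T : measurableType d) (R : realType).

(* The sigma-algebra generated by xi 0, ..., xi k.-1; trivial for k = 0. *)
Definition history d' (Xi : measurableType d') (xi : nat -> T -> Xi) (k : nat)
    : set (set T) :=
  g_sigma_preimage (fun i : 'I_k => xi i).

Definition measurable_wrt (G : set (set T)) (Y : T -> R) : Prop :=
  preimage_set_system setT Y measurable `<=` G.

(* W is a version of the conditional expectation of Y given the
   sub-sigma-algebra G. *)
Definition is_cond_exp (P : probability T R) (G : set (set T)) (Y W : T -> R)
    : Prop :=
  [/\ P.-integrable setT (EFin \o Y), P.-integrable setT (EFin \o W),
      measurable_wrt G W &
      forall B, G B ->
        (\int[P]_(w in B) (W w)%:E = \int[P]_(w in B) (Y w)%:E)%E].

(* E[Y | G] <= Z almost surely; versions being almost surely equal, it does not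
   matter which one is used. *)
Definition cond_exp_le (P : probability T R) (G : set (set T)) (Y Z : T -> R)
    : Prop :=
  exists W, is_cond_exp P G Y W /\ {ae P, forall w, W w <= Z w}.

End ConditionalExpectation.

Section InexactnessConditions.
Context d (T : measurableType d) (R : realType) (P : probability T R).
Variables (m n : nat) (f : 'cV[R]_n -> R) (A : 'M[R]_(m, n)) (b : 'cV[R]_m).
Variables (X : set 'cV[R]_n) (alpha : R).
(* Data of one outer iteration: G is the past, x the computed point, xstar a
   minimizer of the augmented Lagrangian for the multiplier l. *)
Variables (G : set (set T)) (x xstar : T -> 'cV[R]_n) (l : T -> 'cV[R]_m).

Definition inexact_a (theta tau : R) : Prop :=
  cond_exp_le P G
    (fun w => norm2 (constr A b (xstar w) - constr A b (x w)) ^+ 2)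
    (fun w => theta ^+ 2 * norm2 (constr A b (xstar w)) ^+ 2 + tau).

Definition inexact_b (theta tau : R) : Prop :=
  cond_exp_le P G
    (fun w => auglagr f A b alpha (x w) (l w)
              - auglagr f A b alpha (xstar w) (l w))
    (fun w => alpha * theta ^+ 2 * norm2 (constr A b (xstar w)) ^+ 2 / 2
              + alpha * tau / 2).

(* The upper bound 1 / (L + alpha |A|^2) on the step is written as a product, so
   that it means +oo when the denominator vanishes. When A = 0, the bounds with
   |A| in the denominator are read with x / 0 = 0, i.e. they force
   theta' = tau' = 0. *)
Definition inexact_c (L mu eta theta tau theta' tau' : R) : Prop :=
  [/\ 0 < mu /\
      (forall v : 'cV[R]_m, strongly_convex_on X mu (auglagr f A b alpha ^~ v)),
      0 < eta /\ eta * (L + alpha * opnorm A ^+ 2) < 1,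
      0 <= theta' < 1 /\ theta' <= mu * theta / (2 * opnorm A),
      0 <= tau' /\ tau' <= mu ^+ 2 * tau / (4 * opnorm A ^+ 2) &
      cond_exp_le P G
        (fun w => norm2 (redgrad f A b X alpha eta (x w) (l w)) ^+ 2)
        (fun w => theta' ^+ 2 * norm2 (constr A b (xstar w)) ^+ 2 + tau')].

End InexactnessConditions.

(* Main.v *)
Require Import Defs.
From HB Require Import structures.
From mathcomp Require Import all_boot all_order all_algebra.
From mathcomp Require Import all_classical all_reals all_analysis.
From mathcomp Require Import measurable_realfun.
From mathcomp Require Import ring lra.

Set Implicit Arguments.
Unset Strict Implicit.
Unset Printing Implicit Defensive.

Import Order.TTheory GRing.Theory Num.Theory.
Import numFieldNormedType.Exports.

Local Open Scope classical_set_scope.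
Local Open Scope ring_scope.

(** The method is an inexact proximal point method on the negative dual function
    q, and everything rests on one pathwise inequality for its Moreau envelope.

    Let xs minimize the augmented Lagrangian at u over X. The optimality
    condition and convexity make xs a minimizer of the ordinary Lagrangian at
    [u - alpha c(xs)] as well ([argmin_lagr]), so that this multiplier is the proximal point of u and the envelope at u equals minus the
    minimal value of the augmented Lagrangian ([env_ge], [env_le]). Using the
    same proximal point as a trial point in the envelope at the inexact update
    [u - alpha c(x)] gives ([env_descent])

      env (u - alpha c(x)) <= env u - alpha/2 |c(xs)|^2
                                    + alpha/2 |c(xs) - c(x)|^2.

    The given primal-dual pair is a saddle point, which identifies the minimum
    of the envelope as minus the optimal value of f ([env_minimum]).
    Telescoping bounds the sums of |c(xs_k)|^2 - |c(xs_k) - c(x_k)|^2 along every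
    realization ([sum_env_descent]).

    Each inexactness condition yields an integrable bound Y_k on
    |c(xs_k) - c(x_k)|^2 with conditional mean at most
    theta^2 |c(xs_k)|^2 + tau_k ([majorant]): condition (a) directly, (b) by
    quadratic growth of the augmented Lagrangian in the constraint value, and
    (c) by the error bound |xs - x| <= (2 / mu) |R| for strongly convex
    objectives ([redgrad_error_bound]). Averaging the telescoped inequality
    ([sum_majorants]) bounds both the sum of E|c(x_k)|^2, whence the first limit
    and the rate, and the sum of E[Y_k]. The minimizers xs_k are chosen freely,
    so functions of them need not be measurable; the averaging therefore works
    with weights that eliminate |c(xs_k)|^2 before integration.

    For the last claim, the reduced gradient of the ordinary Lagrangian at
    (x_k, lambda_{k+1}) is that of the augmented Lagrangian at (x_k, lambda_k)
    ([redgrad0_redgrad]). Its square is at most a constant times Y_k: in case (b)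
    because a projected gradient step decreases the augmented Lagrangian
    ([redgrad_decrease]), in case (c) because reduced gradients at different
    steps are comparable ([projgrad_step_le]). *)

(** * Euclidean vectors and the induced matrix norm *)

Section EuclideanGeometry.
Variable R : realType.
Implicit Types m n : nat.

Lemma dotvE n (u v : 'cV[R]_n) : dotv u v = (u^T *m v) 0 0.
Proof. by rewrite mxE; apply: eq_bigr => i _; rewrite mxE. Qed.

Lemma dotvC n (u v : 'cV[R]_n) : dotv u v = dotv v u.
Proof. by apply: eq_bigr => i _; rewrite mulrC. Qed.

Lemma dotvDr n (u v w : 'cV[R]_n) : dotv u (v + w) = dotv u v + dotv u w.
Proof. by rewrite !dotvE mulmxDr mxE. Qed.

Lemma dotvZr n a (u v : 'cV[R]_n) : dotv u (a *: v) = a * dotv u v.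
Proof. by rewrite !dotvE -scalemxAr mxE. Qed.

Lemma dotvDl n (u v w : 'cV[R]_n) : dotv (u + v) w = dotv u w + dotv v w.
Proof. by rewrite ![dotv _ w]dotvC dotvDr. Qed.

Lemma dotvZl n a (u v : 'cV[R]_n) : dotv (a *: u) v = a * dotv u v.
Proof. by rewrite ![dotv _ v]dotvC dotvZr. Qed.

Lemma dotvNr n (u v : 'cV[R]_n) : dotv u (- v) = - dotv u v.
Proof. by rewrite -scaleN1r dotvZr mulN1r. Qed.

Lemma dotvNl n (u v : 'cV[R]_n) : dotv (- u) v = - dotv u v.
Proof. by rewrite -scaleN1r dotvZl mulN1r. Qed.

Definition dotv_lin := (dotvDl, dotvDr, dotvZl, dotvZr, dotvNl, dotvNr).

Lemma dotv_mulmx m n (A : 'M[R]_(m, n)) u v :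
  dotv u (A *m v) = dotv (A^T *m u) v.
Proof. by rewrite !dotvE trmx_mul trmxK mulmxA. Qed.

Lemma dotv_delta n (u : 'cV[R]_n) i : dotv u (delta_mx i 0) = u i 0.
Proof.
rewrite /dotv (bigD1 i)//= big1 ?addr0 ?mxE ?eqxx ?mulr1// => j ji.
by rewrite mxE (negbTE ji) mulr0.
Qed.

Lemma dotv_ge0 n (u : 'cV[R]_n) : 0 <= dotv u u.
Proof. by apply: sumr_ge0 => i _; rewrite -expr2 sqr_ge0. Qed.

Lemma norm2_ge0 n (u : 'cV[R]_n) : 0 <= norm2 u.
Proof. exact: sqrtr_ge0. Qed.

Lemma sqr_norm2 n (u : 'cV[R]_n) : norm2 u ^+ 2 = dotv u u.
Proof. by rewrite sqr_sqrtr// dotv_ge0. Qed.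

Lemma norm2_eq0 n (u : 'cV[R]_n) : norm2 u = 0 -> u = 0.
Proof.
move=> u0; have := sqr_norm2 u; rewrite u0 expr0n/= => /esym/psumr_eq0P uu.
apply/matrixP => i j; rewrite ord1 mxE.
by apply/eqP; rewrite -sqrf_eq0 expr2 uu// => k _; rewrite -expr2 sqr_ge0.
Qed.

Lemma norm2Z n a (u : 'cV[R]_n) : norm2 (a *: u) = `|a| * norm2 u.
Proof.
by rewrite /norm2 !dotv_lin mulrA -expr2 sqrtrM ?sqr_ge0// sqrtr_sqr.
Qed.

Lemma norm2N n (u : 'cV[R]_n) : norm2 (- u) = norm2 u.
Proof. by rewrite /norm2 !dotv_lin opprK. Qed.

Lemma norm2_0 n : norm2 (0 : 'cV[R]_n) = 0.
Proof. by rewrite -(scale0r (0 : 'cV[R]_n)) norm2Z normr0 mul0r. Qed.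

(** Cauchy-Schwarz, from [0 <= |b u - a v|^2] where a and b are the norms. *)
Lemma dotv_le_norm2 n (u v : 'cV[R]_n) : dotv u v <= norm2 u * norm2 v.
Proof.
have [u0|u0] := eqVneq (norm2 u) 0.
  by rewrite u0 mul0r (norm2_eq0 u0) -(scale0r (0 : 'cV[R]_n)) dotvZl mul0r.
have [v0|v0] := eqVneq (norm2 v) 0.
  by rewrite v0 mulr0 (norm2_eq0 v0) -(scale0r (0 : 'cV[R]_n)) dotvZr mul0r.
have ugt0 : 0 < norm2 u by rewrite lt_neqAle eq_sym u0 norm2_ge0.
have vgt0 : 0 < norm2 v by rewrite lt_neqAle eq_sym v0 norm2_ge0.
have := dotv_ge0 (norm2 v *: u - norm2 u *: v).
rewrite !dotv_lin (dotvC v u) -!sqr_norm2 => h.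
rewrite -subr_ge0 -(pmulr_rge0 _ (mulr_gt0 ugt0 vgt0)).
lra.
Qed.

Lemma sqr_dotv_le n (u v : 'cV[R]_n) :
  dotv u v ^+ 2 <= norm2 u ^+ 2 * norm2 v ^+ 2.
Proof.
rewrite -exprMn -real_normK ?num_real// lerXn2r ?nnegrE ?mulr_ge0 ?norm2_ge0//.
by rewrite ler_norml dotv_le_norm2 lerNl -dotvNl -(norm2N u) dotv_le_norm2.
Qed.

(** The Frobenius norm bounds the induced one, so that the supremum defining
    [opnorm] is over a bounded set. *)
Lemma norm2_mulmx_bound m n (A : 'M[R]_(m, n)) :
  exists C, forall x, norm2 (A *m x) <= C * norm2 x.
Proof.
pose F := \sum_i norm2 (row i A)^T ^+ 2.
have F0 : 0 <= F by apply: sumr_ge0 => i _; rewrite sqr_ge0.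
exists (Num.sqrt F) => x.
rewrite -(@ler_pXn2r _ 2)// ?nnegrE ?mulr_ge0 ?norm2_ge0 ?sqrtr_ge0//.
rewrite exprMn (sqr_sqrtr F0) [leLHS]sqr_norm2 mulr_suml.
apply: ler_sum => i _.
have -> : (A *m x) i 0 = dotv (row i A)^T x.
  by rewrite mxE; apply: eq_bigr => j _; rewrite !mxE.
by rewrite -expr2 sqr_dotv_le.
Qed.

Lemma opnorm_ge m n (A : 'M[R]_(m, n)) x :
  norm2 x <= 1 -> norm2 (A *m x) <= opnorm A.
Proof.
move=> x1; apply: ub_le_sup; last by exists x.
have [C hC] := norm2_mulmx_bound A.
exists `|C| => _ [y /= y1 <-]; apply: (le_trans (hC y)).
apply: (le_trans (ler_wpM2r (norm2_ge0 y) (ler_norm C))).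
by rewrite -{2}(mulr1 `|C|) ler_wpM2l.
Qed.

Lemma opnorm_ge0 m n (A : 'M[R]_(m, n)) : 0 <= opnorm A.
Proof. by rewrite -(norm2_0 m) -(mulmx0 1 A) opnorm_ge// norm2_0. Qed.

Lemma norm2_mulmx_le m n (A : 'M[R]_(m, n)) x :
  norm2 (A *m x) <= opnorm A * norm2 x.
Proof.
have [x0|x0] := eqVneq (norm2 x) 0.
  by rewrite x0 mulr0 (norm2_eq0 x0) mulmx0 norm2_0.
have xgt0 : 0 < norm2 x by rewrite lt_neqAle eq_sym x0 norm2_ge0.
rewrite -ler_pdivrMr// mulrC -{1}(ger0_norm (ltW xgt0)) -normfV -norm2Z.
rewrite scalemxAr opnorm_ge//.
by rewrite norm2Z normfV ger0_norm ?mulVf// ltW.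
Qed.

End EuclideanGeometry.

(** * Convex sets, projections and directional derivatives *)

Section ConvexMinimization.
Variables (R : realType) (n : nat).
Implicit Types (X : set 'cV[R]_n) (x y z : 'cV[R]_n).

Lemma convex_segment X x y t : convex_set X -> X x -> X y -> 0 <= t <= 1 ->
  X (t *: y + (1 - t) *: x).
Proof.
move=> cX Xx Xy /andP[t0 t1].
by have /set_mem := cX y x (Itv01 t0 t1) (mem_set Xy) (mem_set Xx).
Qed.

Lemma convex_function_segment X (f : 'cV[R]_n -> R) x y t :
  convex_function X (f : 'cV[R]_n -> R^o) -> X x -> X y -> 0 <= t <= 1 ->
  f (t *: y + (1 - t) *: x) <= t * f y + (1 - t) * f x.
Proof.
move=> cf Xx Xy /andP[t0 t1].
exact: (cf (Itv01 t0 t1) y x (mem_set Xy) (mem_set Xx)).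
Qed.

Lemma segmentE x y t : t *: y + (1 - t) *: x = x + t *: (y - x).
Proof. by rewrite scalerBr scalerBl scale1r addrCA. Qed.

(** The first-order step: an inequality [0 <= t a + t^2 b] for small t > 0,
    divided by t, gives [0 <= a] in the limit. *)
Lemma ge0_of_small_slope (a b : R) :
  (forall t, 0 < t <= 1 -> 0 <= a + t * b) -> 0 <= a.
Proof.
move=> h; rewrite leNgt; apply/negP => a0.
pose t := - a / (`|b| - a).
have nb := ler_norm b; have nb0 := normr_ge0 b.
have d0 : 0 < `|b| - a by lra.
(* with this t, t * |b| < - a *)
have : 0 < t <= 1.
  by rewrite /t divr_gt0 ?oppr_gt0//= ler_pdivrMr//; lra.
move=> /[dup] /andP[t0 t1] /h.
have : t * (`|b| - a) = - a by rewrite /t divfK// gt_eqF.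
nra.
Qed.

Lemma dotv_continuous (z : 'cV[R]_n) :
  continuous (fun y => dotv (y - z) (y - z) : R).
Proof.
have cE i : continuous (fun y : 'cV[R]_n => (y - z) i 0).
  have -> : (fun y : 'cV[R]_n => (y - z) i 0) = (fun y => y i 0 - z i 0).
    by apply/funext => y; rewrite !mxE.
  by move=> y; apply: cvgB (@coord_continuous R n 1 i 0 y) (cvg_cst _).
apply: continuous_big => [|i _ y]; first exact: add_continuous.
exact: cvgM (cE i y) (cE i y).
Qed.

Lemma eproj_argmin X z : X !=set0 -> compact X ->
  is_argmin X (fun y => norm2 (y - z)) (eproj X z).
Proof.
move=> X0 cX; apply: xgetPex.
have [//|c /set_mem Xc hc] := compact_EVT_min X0 cX
   (f := fun y => dotv (y - z) (y - z)).
  by apply: continuous_subspaceT; exact: dotv_continuous.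
exists c; split=> // y Xy.
by rewrite ler_sqrt ?dotv_ge0// hc// mem_set.
Qed.

(** The variational inequality of the projection: the squared distance to z
    cannot decrease to first order when moving from the projection towards y. *)
Lemma eproj_vi X z y : X !=set0 -> compact X -> convex_set X -> X y ->
  dotv (z - eproj X z) (y - eproj X z) <= 0.
Proof.
move=> X0 cX vX Xy; have [Xp hp] := eproj_argmin z X0 cX.
set p := eproj X z in Xp hp *.
rewrite -oppr_ge0; apply: (@ge0_of_small_slope _ (dotv (y - p) (y - p) / 2)).
move=> t /andP[t0 t1].
have t01 : 0 <= t <= 1 by rewrite t1 ltW.
have := hp _ (convex_segment vX Xp Xy t01).
rewrite segmentE ler_sqrt ?dotv_ge0//.
have -> : p + t *: (y - p) - z = t *: (y - p) - (z - p).
  by rewrite opprB -addrA [RHS]addrCA.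
have -> : p - z = - (z - p) by rewrite opprB.
move: (z - p) (y - p) => q v; rewrite !dotv_lin (dotvC v q) => h.
by rewrite -(pmulr_rge0 _ t0); lra.
Qed.

Definition dirquot (g : 'cV[R]_n -> R) x v (h : R) : R :=
  h^-1 * (g (x + h *: v) - g x).

Lemma grad_dirquot (f : 'cV[R]_n -> R) x v :
  differentiable (f : 'cV[R]_n -> R^o) x ->
  dirquot f x v h @[h --> 0^'] --> dotv (grad f x) v.
Proof.
move=> df.
have -> : dotv (grad f x) v = 'D_v (f : 'cV[R]_n -> R^o) x.
  rewrite deriveE// {2}(matrix_sum_delta v) linear_sum.
  apply: eq_bigr => i _; rewrite big_ord1 linearZ mxE deriveE//.
  by rewrite mulrC.
have -> : dirquot f x v = (fun h =>
    h^-1 *: (((f : 'cV[R]_n -> R^o) \o shift x) (h *: v) - f x)).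
  by apply/funext => h; rewrite /dirquot /= (addrC x).
exact: diff_derivable.
Qed.

(** Lets a gradient be read off an explicit expansion along lines. *)
Lemma dirquot_grad (g : 'cV[R]_n -> R) x d :
  (forall v, dirquot g x v h @[h --> 0^'] --> dotv d v) -> grad g x = d.
Proof.
move=> hg; apply/matrixP => i j; rewrite ord1 mxE -dotv_delta.
have := hg (delta_mx i 0).
have -> : dirquot g x (delta_mx i 0) = (fun h =>
    h^-1 *: (((g : 'cV[R]_n -> R^o) \o shift x) (h *: delta_mx i 0) - g x)).
  by apply/funext => h; rewrite /dirquot /= (addrC x).
exact: cvg_lim.
Qed.

(** Used with the convexity inequality ([c = 0]) and the strong convexity
    inequality, whose defect t (1 - t) produces the term in t^2. *)
Lemma dirquot_le (g : 'cV[R]_n -> R) x v (a b c : R) :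
  dirquot g x v h @[h --> 0^'] --> a ->
  (forall t, 0 < t <= 1 -> g (x + t *: v) - g x <= t * (b + t * c)) -> a <= b.
Proof.
move=> /cvg_dnbhs_at_right ga hb.
have hr : (b + h * c) @[h --> 0^'+] --> b.
  rewrite -[X in _ --> X]addr0 -[X in _ + X](mul0r c).
  apply: cvg_at_right_filter.
  by apply: cvgD; [exact: cvg_cst | apply: cvgM; [exact: cvg_id | exact: cvg_cst]].
apply: (ler_cvg_to ga hr).
near=> h.
have h0 : 0 < h by [].
have h1 : h <= 1.
  by near: h; apply: nbhs_right_le.
rewrite /dirquot mulrC ler_pdivrMr// mulrC.
by apply: hb; rewrite h0.
Unshelve. all: by end_near. Qed.

End ConvexMinimization.

(** * Gradient inequalities, projected gradients, augmented Lagrangians *)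

Section ConvexDifferentiable.
Variables (R : realType) (n : nat) (X : set 'cV[R]_n) (f : 'cV[R]_n -> R).
Hypothesis vf : convex_function X (f : 'cV[R]_n -> R^o).
Hypothesis df : forall x, X x -> differentiable (f : 'cV[R]_n -> R^o) x.

Lemma convex_grad_le x y : X x -> X y -> dotv (grad f x) (y - x) <= f y - f x.
Proof.
move=> Xx Xy; apply: (dirquot_le (c := 0) (grad_dirquot (v := y - x) (df Xx))).
move=> t /andP[t0 t1]; have t01 : 0 <= t <= 1 by rewrite t1 ltW.
by have := convex_function_segment vf Xx Xy t01; rewrite segmentE; lra.
Qed.

(** The gradient inequality at p, corrected by the variation of the gradient
    between x and p, already gives a quadratic upper bound; the constant is L instead of the sharp L / 2, which is harmless
    below because the step sizes satisfy [eta * L < 1]. *)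
Lemma lipschitz_grad_le L x p : lipschitz2_on X L (grad f) -> X x -> X p ->
  f p - f x <= dotv (grad f x) (p - x) + L * norm2 (p - x) ^+ 2.
Proof.
move=> lf Xx Xp; have := convex_grad_le Xp Xx.
have -> : x - p = - (p - x) by rewrite opprB.
have {1}-> : grad f p = grad f x + (grad f p - grad f x) by rewrite addrC subrK.
have := dotv_le_norm2 (grad f p - grad f x) (p - x).
have := ler_wpM2r (norm2_ge0 (p - x)) (lf _ _ Xp Xx).
move: (grad f p - grad f x) (p - x) => d v.
by rewrite dotvNr dotvDl; lra.
Qed.

Lemma compact_norm2_bounded (z : 'cV[R]_n) : X !=set0 -> compact X ->
  exists D, forall x, X x -> norm2 (x - z) <= D.
Proof.
move=> X0 cX; have [|c _ hc] := compact_EVT_max X0 cX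
    (f := fun y : 'cV[R]_n => dotv (y - z) (y - z)).
  by apply: continuous_subspaceT; exact: dotv_continuous.
exists (norm2 (c - z)) => x Xx.
by rewrite ler_sqrt ?dotv_ge0// hc// mem_set.
Qed.

End ConvexDifferentiable.

Section ProjectedGradient.
Variables (R : realType) (n : nat) (X : set 'cV[R]_n).
Hypotheses (X0 : X !=set0) (cX : compact X) (vX : convex_set X).

Lemma projgrad_in g eta x : eta != 0 -> X (x + eta *: projgrad X g eta x).
Proof.
move=> e0; rewrite /projgrad scalerA divff// scale1r addrC subrK.
exact: (eproj_argmin _ X0 cX).1.
Qed.

(** The variational inequality of the projection, written at the end point
    [x + eta r] of the step in terms of the reduced gradient r. *)
Lemma projgrad_vi g eta x y : 0 < eta -> X y ->
  0 <= dotv (projgrad X g eta x + g) (y - (x + eta *: projgrad X g eta x)).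
Proof.
move=> e0 Xy; have := eproj_vi (x - eta *: g) X0 cX vX Xy.
set r := projgrad X g eta x.
have -> : eproj X (x - eta *: g) = x + eta *: r.
  by rewrite /r /projgrad scalerA divff ?gt_eqF// scale1r [RHS]addrC subrK.
have -> : x - eta *: g - (x + eta *: r) = - (eta *: (r + g)).
  by rewrite scalerDr !opprD addrACA subrr add0r addrC.
by rewrite dotvNl dotvZl oppr_le0 pmulr_rge0.
Qed.

(** Reduced gradients at different step sizes are comparable: add the
    variational inequalities of the two projections. *)
Lemma projgrad_step_le g eta eta' x : 0 < eta -> 0 < eta' ->
  norm2 (projgrad X g eta x) <= (1 + eta' / eta) * norm2 (projgrad X g eta' x).
Proof.
move=> e0 e0'.
have := projgrad_vi g x e0 (projgrad_in g x (lt0r_neq0 e0')).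
have := projgrad_vi g x e0' (projgrad_in g x (lt0r_neq0 e0)).
move: (projgrad X g eta x) (projgrad X g eta' x) => r r'.
have dE (a a' : R) (s s' : 'cV[R]_n) :
    x + a *: s - (x + a' *: s') = a *: s - a' *: s'.
  by rewrite opprD addrACA subrr add0r.
rewrite !dE.
have h := dotv_le_norm2 r r'.
have q := sqr_norm2 r.
have q' := dotv_ge0 r'.
have n0 := norm2_ge0 r'.
rewrite !dotv_lin (dotvC r' r) => h1 h2.
have {h1 h2} : eta * norm2 r ^+ 2 <= (eta + eta') * (norm2 r * norm2 r').
  rewrite q.
  have : (eta + eta') * dotv r r' <= (eta + eta') * (norm2 r * norm2 r').
    by rewrite ler_wpM2l// addr_ge0// ltW.
  have : 0 <= eta' * dotv r' r' by rewrite mulr_ge0// ltW.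
  lra.
have [->|r0] := eqVneq (norm2 r) 0.
  by rewrite mulr_ge0// addr_ge0// divr_ge0// ltW.
have rgt0 : 0 < norm2 r by rewrite lt_neqAle eq_sym r0 norm2_ge0.
rewrite expr2 mulrCA [leRHS]mulrCA ler_pM2l// mulrC -ler_pdivlMr//.
by move=> /le_trans; apply; rewrite mulrAC mulrDl divff// gt_eqF.
Qed.

End ProjectedGradient.

Section AugmentedLagrangian.
Variables (R : realType) (m n : nat).
Variables (f : 'cV[R]_n -> R) (A : 'M[R]_(m, n)) (b : 'cV[R]_m).
Variable alpha : R.
Implicit Types (x y v : 'cV[R]_n) (u : 'cV[R]_m).
Local Notation c := (constr A b).
Local Notation AL := (auglagr f A b alpha).

Lemma constrB x y : c y - c x = A *m (y - x).
Proof. by rewrite /constr mulmxBr opprB addrA subrK. Qed.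

(** The augmented Lagrangian is f plus a quadratic; the linear part of the latter
    at x involves u only through the updated multiplier [u - alpha c(x)]. *)
Lemma auglagr_expand x v t u :
  AL (x + t *: v) u - AL x u = f (x + t *: v) - f x
    - t * dotv (u - alpha *: c x) (A *m v)
    + alpha / 2 * t ^+ 2 * norm2 (A *m v) ^+ 2.
Proof.
have cE : c (x + t *: v) = c x + t *: (A *m v).
  by rewrite /constr mulmxDr -scalemxAr addrAC.
rewrite /auglagr !sqr_norm2 cE; move: (A *m v) (c x) => w d.
by rewrite !dotv_lin (dotvC w d); field.
Qed.

(** Facts on the gradient of the ordinary Lagrangian are read off those for the
    augmented one. *)
Lemma lagr_auglagr0 : lagr f A b = auglagr f A b 0.
Proof. by apply/funext => x; apply/funext => l; rewrite /auglagr !mul0r addr0. Qed.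

Lemma dirquot_auglagr x u v : differentiable (f : 'cV[R]_n -> R^o) x ->
  dirquot (AL ^~ u) x v h @[h --> 0^']
    --> dotv (grad f x - A^T *m (u - alpha *: c x)) v.
Proof.
move=> dfx.
have -> : dotv (grad f x - A^T *m (u - alpha *: c x)) v =
    dotv (grad f x) v
      + (- dotv (u - alpha *: c x) (A *m v) + 0 * (alpha / 2 * norm2 (A *m v) ^+ 2)).
  by rewrite mul0r addr0 dotv_mulmx dotvDl dotvNl.
have : (dirquot f x v h
      + (- dotv (u - alpha *: c x) (A *m v) + h * (alpha / 2 * norm2 (A *m v) ^+ 2)))
    @[h --> 0^'] --> dotv (grad f x) v
      + (- dotv (u - alpha *: c x) (A *m v) + 0 * (alpha / 2 * norm2 (A *m v) ^+ 2)).
  apply: cvgD; first exact: grad_dirquot.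
  apply: cvgD; first exact: cvg_cst.
  apply: cvgM; last exact: cvg_cst.
  exact: nbhs_dnbhs.
apply: cvg_trans; apply: near_eq_cvg; near=> h.
rewrite /dirquot auglagr_expand.
have h0 : h != 0 by near: h; exact: nbhs_dnbhs_neq.
by field.
Unshelve. all: by end_near. Qed.

Lemma grad_auglagr x u : differentiable (f : 'cV[R]_n -> R^o) x ->
  grad (AL ^~ u) x = grad f x - A^T *m (u - alpha *: c x).
Proof. by move=> dfx; apply: dirquot_grad => v; exact: dirquot_auglagr. Qed.

End AugmentedLagrangian.

(** * Moreau envelope of the dual function; reduced gradients *)

Section Duality.
Variables (R : realType) (m n : nat).
Variables (f : 'cV[R]_n -> R) (A : 'M[R]_(m, n)) (b : 'cV[R]_m).
Variables (X : set 'cV[R]_n) (alpha : R).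
Hypotheses (X0 : X !=set0) (cX : compact X) (vX : convex_set X).
Hypothesis vf : convex_function X (f : 'cV[R]_n -> R^o).
Hypothesis df : forall x, X x -> differentiable (f : 'cV[R]_n -> R^o) x.
Hypothesis alpha0 : 0 < alpha.
Implicit Types (x y v : 'cV[R]_n) (u l : 'cV[R]_m).
Local Notation c := (constr A b).
Local Notation AL := (auglagr f A b alpha).
Local Notation LL := (lagr f A b).
Local Notation env := (negdual_env f A b X alpha).

(** Optimality of x for the augmented Lagrangian at u is optimality of x for the
    ordinary Lagrangian at the updated multiplier [u - alpha c(x)]: compare x with
    points of the segment to y, on which f is below its chord. *)
Lemma argmin_vi x y u : is_argmin X (AL ^~ u) x -> X y ->
  0 <= f y - f x - dotv (u - alpha *: c x) (c y - c x).
Proof.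
move=> [Xx hx] Xy; rewrite constrB.
apply: (@ge0_of_small_slope _ _ (alpha / 2 * norm2 (A *m (y - x)) ^+ 2)).
move=> t /andP[t0 t1]; have t01 : 0 <= t <= 1 by rewrite t1 ltW.
have := hx _ (convex_segment vX Xx Xy t01).
have := convex_function_segment vf Xx Xy t01.
rewrite segmentE -subr_ge0 => h1; rewrite -subr_ge0 auglagr_expand => h2.
by rewrite -(pmulr_rge0 _ t0); lra.
Qed.

(** The quadratic term gives the augmented Lagrangian quadratic growth in the
    constraint value. *)
Lemma auglagr_growth x y u : is_argmin X (AL ^~ u) x -> X y ->
  alpha / 2 * norm2 (c x - c y) ^+ 2 <= AL y u - AL x u.
Proof.
move=> hx Xy; have := argmin_vi hx Xy.
have := auglagr_expand f A b alpha x (y - x) 1 u.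
rewrite scale1r (addrC x) subrK => ->.
rewrite -(opprB (c y)) norm2N constrB expr1n; lra.
Qed.

Lemma argmin_lagr x u : is_argmin X (AL ^~ u) x ->
  is_argmin X (LL ^~ (u - alpha *: c x)) x.
Proof.
move=> hx; split; first exact: hx.1.
move=> y Xy; have := argmin_vi hx Xy; rewrite /lagr.
by move: (c x) (c y) => d e; move: (u - _) => w; rewrite dotvDr dotvNr; lra.
Qed.

(** Boundedness below makes the infimum defining [negdual] meaningful; it comes
    from the tangent minorant of f at a point of the bounded set X. *)
Lemma lagr_lbound l : has_lbound [set LL x l | x in X].
Proof.
have [x0 Xx0] := X0.
have [D hD] := compact_norm2_bounded x0 X0 cX.
pose g := grad f x0 - A^T *m l.
exists (LL x0 l - norm2 g * D) => _ [y Xy <-].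
have h1 := convex_grad_le vf df Xx0 Xy.
have h2 := dotv_le_norm2 (- g) (y - x0).
have h3 := ler_wpM2l (norm2_ge0 g) (hD _ Xy).
have h4 : dotv l (c y) - dotv l (c x0) = dotv (A^T *m l) (y - x0).
  by rewrite -dotv_mulmx -(constrB A b) dotvDr dotvNr.
move: h2; rewrite norm2N dotvNl /g dotvDl dotvNl.
rewrite /lagr; lra.
Qed.

Lemma negdual_ge x l : X x -> - LL x l <= negdual f A b X l.
Proof.
move=> Xx; rewrite lerN2; apply: ge_inf; first exact: lagr_lbound.
by exists x.
Qed.

Lemma negdual_argmin x l : is_argmin X (LL ^~ l) x -> negdual f A b X l = - LL x l.
Proof.
move=> [Xx hx]; apply/eqP; rewrite eq_le negdual_ge// andbT lerN2.
apply: lb_le_inf; first by exists (LL x l); exists x.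
by move=> _ [y Xy <-]; exact: hx.
Qed.

(** Weak duality: the infimum over l of [- LL x l + |l - u|^2 / (2 alpha)] is
    found by completing the square, and equals [- AL x u]. *)
Lemma env_term_ge x u l : X x ->
  - AL x u <= negdual f A b X l + (2 * alpha)^-1 * norm2 (l - u) ^+ 2.
Proof.
move=> Xx; apply: le_trans (lerD (negdual_ge l Xx) (lexx _)).
have -> : l = u + (l - u) by rewrite addrC subrK.
move: (l - u) => w; rewrite addrAC subrr add0r.
rewrite /lagr /auglagr !sqr_norm2; move: (c x) => d.
have h := dotv_ge0 (w + alpha *: d).
have -> : (2 * alpha)^-1 * dotv w w =
    (2 * alpha)^-1 * dotv (w + alpha *: d) (w + alpha *: d)
    - dotv w d - alpha / 2 * dotv d d.
  by rewrite !dotv_lin (dotvC d w); field; rewrite gt_eqF.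
have : 0 <= (2 * alpha)^-1 * dotv (w + alpha *: d) (w + alpha *: d).
  by rewrite mulr_ge0// invr_ge0 mulr_ge0// ltW.
by rewrite (dotvDl u w); lra.
Qed.

Lemma env_ge x u : X x -> - AL x u <= env u.
Proof.
move=> Xx; apply: lb_le_inf.
  by eexists; exists 0.
by move=> _ [l _ <-]; exact: env_term_ge.
Qed.

Lemma env_le x u l : is_argmin X (LL ^~ l) x ->
  env u <= - LL x l + (2 * alpha)^-1 * norm2 (l - u) ^+ 2.
Proof.
move=> hx; rewrite -(negdual_argmin hx); apply: ge_inf; last by exists l.
by exists (- AL x u) => _ [l' _ <-]; exact: env_term_ge hx.1.
Qed.

(** Descent of the Moreau envelope along an inexact multiplier step: the exact
    update [u - alpha c(x)] is the proximal point of u, and it is compared as a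
    trial point in the envelope at the inexact update. *)
Lemma env_descent x u (d : 'cV[R]_m) : is_argmin X (AL ^~ u) x ->
  env (u - alpha *: d) <= env u - alpha / 2 * norm2 (c x) ^+ 2
                          + alpha / 2 * norm2 (c x - d) ^+ 2.
Proof.
move=> hx; have := env_ge u hx.1.
have := env_le (u - alpha *: d) (argmin_lagr hx).
have -> : u - alpha *: c x - (u - alpha *: d) = - alpha *: (c x - d).
  move: (c x) => e; rewrite scaleNr scalerBr !opprB.
  rewrite [alpha *: d - u]addrC addrACA subrr add0r.
  by rewrite addrC.
rewrite norm2Z normrN gtr0_norm// exprMn.
have -> e : (2 * alpha)^-1 * (alpha ^+ 2 * e) = alpha / 2 * e.
  by field; rewrite gt_eqF.
rewrite /auglagr /lagr !sqr_norm2 dotvDl dotvNl dotvZl; lra.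
Qed.

(** A saddle point (x, l) with x feasible makes - f x the minimum of the
    envelope, attained at the multiplier l. *)
Lemma env_minimum x l : is_argmin X (LL ^~ l) x -> c x = 0 ->
  is_minimum (range env) (- f x).
Proof.
move=> hx cx0.
have ge u : - f x <= env u.
  have := env_ge u hx.1; rewrite /auglagr cx0 norm2_0.
  by rewrite -(scale0r (0 : 'cV[R]_m)) dotvZr; lra.
split; last by move=> _ [u _ <-].
exists l => //; apply/eqP; rewrite eq_le ge andbT.
have := env_le l hx; rewrite subrr norm2_0 /lagr cx0.
by rewrite -(scale0r (0 : 'cV[R]_m)) dotvZr; lra.
Qed.

(** Stationarity of the ordinary Lagrangian means minimality, by convexity. *)
Lemma kkt_argmin x l eta : 0 < eta -> X x -> redgrad0 f A b X eta x l = 0 ->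
  is_argmin X (LL ^~ l) x.
Proof.
move=> e0 Xx r0; split=> // y Xy.
have := projgrad_vi X0 cX vX (grad (LL ^~ l) x) x e0 Xy.
rewrite -/(redgrad0 f A b X eta x l) r0 scaler0 addr0 add0r.
rewrite lagr_auglagr0 grad_auglagr; last exact: df.
rewrite scale0r subr0 dotvDl dotvNl -dotv_mulmx -(constrB A b).
have := convex_grad_le vf df Xx Xy.
rewrite -lagr_auglagr0 /lagr; move: (c x) (c y) => d e.
by rewrite (dotvDr l) (dotvNr l); lra.
Qed.

End Duality.

Section ReducedGradient.
Variables (R : realType) (m n : nat).
Variables (f : 'cV[R]_n -> R) (A : 'M[R]_(m, n)) (b : 'cV[R]_m).
Variables (X : set 'cV[R]_n) (alpha L : R).
Hypotheses (X0 : X !=set0) (cX : compact X) (vX : convex_set X).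
Hypothesis vf : convex_function X (f : 'cV[R]_n -> R^o).
Hypothesis df : forall x, X x -> differentiable (f : 'cV[R]_n -> R^o) x.
Hypothesis lf : lipschitz2_on X L (grad f).
Hypothesis alpha0 : 0 < alpha.
Implicit Types (x y v : 'cV[R]_n) (u l : 'cV[R]_m).
Local Notation c := (constr A b).
Local Notation AL := (auglagr f A b alpha).
Local Notation rg := (redgrad f A b X alpha).

Lemma auglagr_grad_le x p u : X x -> X p ->
  AL p u - AL x u <= dotv (grad (AL ^~ u) x) (p - x)
                     + (L + alpha * opnorm A ^+ 2) * norm2 (p - x) ^+ 2.
Proof.
move=> Xx Xp; rewrite grad_auglagr; last exact: df.
have := auglagr_expand f A b alpha x (p - x) 1 u.
rewrite scale1r (addrC x) subrK => ->.
move: (u - alpha *: c x) => w; rewrite dotvDl dotvNl -dotv_mulmx.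
have := lipschitz_grad_le vf df lf Xx Xp.
have : norm2 (A *m (p - x)) ^+ 2 <= opnorm A ^+ 2 * norm2 (p - x) ^+ 2.
  by rewrite -exprMn lerXn2r ?nnegrE ?mulr_ge0 ?norm2_ge0 ?opnorm_ge0 ?norm2_mulmx_le.
move=> /(ler_wpM2l (ltW alpha0)).
have := mulr_ge0 (ltW alpha0) (sqr_ge0 (norm2 (A *m (p - x)))).
by rewrite expr1n; lra.
Qed.

(** A projected gradient step of size eta decreases the augmented Lagrangian by
    a multiple of the squared reduced gradient, and the optimality gap is at
    least that decrease. *)
Lemma redgrad_decrease x xs u eta : 0 < eta -> X x ->
  is_argmin X (AL ^~ u) xs ->
  eta * (1 - eta * (L + alpha * opnorm A ^+ 2)) * norm2 (rg eta x u) ^+ 2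
    <= AL x u - AL xs u.
Proof.
move=> e0 Xx [_ hxs].
have Xp := projgrad_in X0 cX (grad (AL ^~ u) x) x (lt0r_neq0 e0).
have := projgrad_vi X0 cX vX (grad (AL ^~ u) x) x e0 Xx.
have := auglagr_grad_le u Xx Xp; have := hxs _ Xp.
rewrite -/(redgrad f A b X alpha eta x u).
move: (rg eta x u) => r.
have -> : x - (x + eta *: r) = - (eta *: r) by rewrite opprD addrA subrr add0r.
have -> : x + eta *: r - x = eta *: r by rewrite addrC addKr.
move: (grad _ _) => g; rewrite norm2Z gtr0_norm// exprMn.
by rewrite dotvNr !dotvZr dotvDl -sqr_norm2; lra.
Qed.

(** Error bound under strong convexity: add the strong convexity inequality at x,
    the quadratic upper bound at the end p of the projected gradient step,
    [AL xs u <= AL p u], and the variational inequality at p. *)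
Lemma redgrad_error_bound mu x xs u eta : 0 < mu ->
  strongly_convex_on X mu (AL ^~ u) ->
  0 < eta -> eta * (L + alpha * opnorm A ^+ 2) < 1 -> X x ->
  is_argmin X (AL ^~ u) xs ->
  norm2 (xs - x) <= 2 / mu * norm2 (rg eta x u).
Proof.
move=> mu0 sc e0 eC Xx [Xxs hxs].
have Xp := projgrad_in X0 cX (grad (AL ^~ u) x) x (lt0r_neq0 e0).
have := projgrad_vi X0 cX vX (grad (AL ^~ u) x) x e0 Xxs.
have := auglagr_grad_le u Xx Xp; have := hxs _ Xp.
have : dotv (grad (AL ^~ u) x) (xs - x)
       <= AL xs u - AL x u - mu / 2 * norm2 (xs - x) ^+ 2.
  rewrite grad_auglagr; last exact: df.
  have hq := @dirquot_auglagr _ _ _ f A b alpha x u (xs - x) (df Xx).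
  apply: (dirquot_le (c := mu / 2 * norm2 (xs - x) ^+ 2) hq).
  move=> t /andP[t0 t1]; have t01 : 0 <= t <= 1 by rewrite t1 ltW.
  by have := sc xs x t Xxs Xx t01; rewrite segmentE; lra.
rewrite -/(redgrad f A b X alpha eta x u).
move: (rg eta x u) => r.
have -> : xs - (x + eta *: r) = xs - x - eta *: r by rewrite opprD addrA.
have -> : x + eta *: r - x = eta *: r by rewrite addrC addKr.
have := dotv_le_norm2 r (xs - x).
have := norm2_ge0 (xs - x).
move: (grad _ _) => g.
move: (xs - x) => v.
rewrite norm2Z gtr0_norm// exprMn.
rewrite !(dotvDl, dotvNr, dotvDr, dotvZr) -!sqr_norm2 => v0 cs h1 h2 h3 h4.
have [->|vn0] := eqVneq (norm2 v) 0.
  by rewrite !mulr_ge0 ?norm2_ge0 ?invr_ge0 ?ltW.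
have vgt0 : 0 < norm2 v by rewrite lt_neqAle eq_sym vn0 v0.
have h5 : 0 <= eta * (1 - eta * (L + alpha * opnorm A ^+ 2)) * norm2 r ^+ 2.
  by rewrite mulr_ge0 ?sqr_ge0// mulr_ge0 ?ltW// subr_gt0.
have : mu / 2 * norm2 v ^+ 2 <= norm2 r * norm2 v by lra.
rewrite expr2 mulrA ler_pM2r// => h.
by rewrite -ler_pdivrMl ?divr_gt0// invf_div.
Qed.

End ReducedGradient.

(** * Expectations and the averaging argument *)

Section RealExpectation.
Context d (T : measurableType d) (R : realType) (P : probability T R).
Implicit Types g h : T -> R.
Local Notation integ g := (P.-integrable setT (EFin \o g)).
Local Notation EE g := (Rintegral P setT g).

Lemma expectation_Rintegral g : integ g -> 'E_P[g]%E = (EE g)%:E.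
Proof.
by move=> ig; rewrite unlock /Rintegral fineK//; exact: integrable_fin_num.
Qed.

Lemma integrableZ g a : integ g -> integ (fun w => a * g w).
Proof. by move=> /(integrableZl measurableT a). Qed.

Lemma integrableDr g h : integ g -> integ h -> integ (fun w => g w + h w).
Proof. by move=> ig /(integrableD measurableT ig). Qed.

Lemma integrable_const a : integ (fun=> a).
Proof. exact: finite_measure_integrable_cst. Qed.

Lemma Rintegral_const a : EE (fun=> a) = a.
Proof. by rewrite Rintegral_cst// (congr1 fine (probability_setT P)) mulr1. Qed.

Lemma ae_le_Rintegral g h : integ g -> integ h ->
  {ae P, forall w, g w <= h w} -> EE g <= EE h.
Proof.
move=> ig ih gh; rewrite -subr_ge0 -RintegralB//.
have iB : integ (fun w => h w - g w) by have := integrableB measurableT ih ig.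
have mB : measurable_fun setT (fun w => h w - g w).
  by case/integrableP : iB => /measurable_EFinP.
have -> : EE (fun w => h w - g w) = EE (fun w => Num.max (h w - g w) 0).
  congr fine; apply: ae_eq_integral => //.
  - exact/measurable_EFinP.
  - by apply/measurable_EFinP; exact: measurable_funrpos.
  - apply: filterS gh => w ghw _ /=.
    by congr EFin; apply/esym/max_idPl; rewrite subr_ge0.
by apply: Rintegral_ge0 => w _; rewrite le_max lexx orbT.
Qed.

Lemma Rintegral_sum K (g : nat -> T -> R) : (forall k, integ (g k)) ->
  integ (fun w => \sum_(k < K) g k w) /\
  EE (fun w => \sum_(k < K) g k w) = \sum_(k < K) EE (g k).
Proof.
move=> ig; elim: K => [|K [iK IH]].
  under eq_fun do rewrite big_ord0.
  by rewrite big_ord0; split; [exact: integrable_const | exact: Rintegral_const].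
have -> : (fun w => \sum_(k < K.+1) g k w)
        = (fun w => \sum_(k < K) g k w + g K w).
  by apply/funext => w; rewrite big_ord_recr.
by rewrite big_ord_recr/= -IH; split; [exact: integrableDr | exact: RintegralD].
Qed.

(** The majorants h may fail to be measurable: they enter only through a
    pathwise bound on their sum. *)
Lemma sum_Rintegral_le K (D : R) (g h : nat -> T -> R) :
  (forall k, integ (g k)) ->
  (forall k, {ae P, forall w, g k w <= h k w}) ->
  (forall w, \sum_(k < K) h k w <= D) ->
  \sum_(k < K) EE (g k) <= D.
Proof.
move=> ig gh hD; have [iK <-] := Rintegral_sum K ig.
rewrite -[leRHS]Rintegral_const; apply: ae_le_Rintegral => //.
  exact: integrable_const.
apply: filterS (ae_foralln gh) => w ghw.
by apply: le_trans (hD w); apply: ler_sum => k _; exact: ghw.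
Qed.

(** The integral of a nonnegative function is the supremum of the integrals of
    the simple functions below it, so that it is monotone even on functions that
    are not measurable. *)
Lemma ge0_le_integral_nonmeas (g h : T -> \bar R) :
  (forall w, 0 <= g w)%E -> (forall w, g w <= h w)%E ->
  (\int[P]_w g w <= \int[P]_w h w)%E.
Proof.
move=> g0 gh; have h0 w : (0 <= h w)%E by exact: le_trans (gh w).
rewrite !ge0_integralTE//; apply: le_ereal_sup => _ [s sg <-].
by exists s => // w; exact: le_trans (gh w).
Qed.

End RealExpectation.

Lemma bounded_series_cvg0 (R : realType) (u : nat -> R) (B : R) :
  (forall k, 0 <= u k) -> (forall K, \sum_(k < K) u k <= B) ->
  u k @[k --> \oo] --> 0.
Proof.
move=> u0 uB; apply: cvg_series_cvg_0; apply: nondecreasing_is_cvgn.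
  by apply/nondecreasing_seqP => K; rewrite !seriesEnat/= big_nat_recr//= lerDl.
by exists B => _ [K _ <-]; rewrite seriesEord; exact: uB.
Qed.

Section Majorants.
Context d (T : measurableType d) (R : realType) (P : probability T R).
Local Notation integ g := (P.-integrable setT (EFin \o g)).
Local Notation EE g := (Rintegral P setT g).

(** The form to which all three inexactness conditions are reduced: an integrable
    bound Y on the squared constraint error e, whose conditional expectation W
    is at most [q s + tau] almost surely, s being the squared residual of the
    exact minimizer. Conditioning survives only as the equality of means. *)
Definition majorant (q tau : R) (s e Y : T -> R) : Prop :=
  [/\ integ Y, forall w, e w <= Y w &
      exists W, [/\ integ W, EE W = EE Y &
                    {ae P, forall w, W w <= q * s w + tau}]].

Lemma cond_exp_le_majorant (G : set (set T)) (Y Z s e : T -> R) (C q tau : R) :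
  G setT -> 0 <= C -> cond_exp_le P G Y Z ->
  (forall w, e w <= C * Y w) -> (forall w, C * Z w <= q * s w + tau) ->
  majorant q tau s e (fun w => C * Y w).
Proof.
move=> GT C0 [W [[iY iW _ WY] WZ]] eY Zs; split=> //; first exact: integrableZ.
exists (fun w => C * W w); split; first exact: integrableZ.
  by rewrite !RintegralZl// /Rintegral WY.
by apply: filterS WZ => w WZw; apply: le_trans (Zs w); rewrite ler_wpM2l.
Qed.

(** The averaging argument. Both bounds integrate a minorant of [s - Y] (times
    q for the second one) whose sum over k is bounded pathwise by D.

    The process s is not assumed measurable, so it must be eliminated before
    integrating. Put [sg = (1 - q) / (1 + q)], the weight for which
    [sg + (1 + sg) q = 1], and split s accordingly: the part sg s is
    bounded below by [sg (nc / 2 - Y)], and the part (1 + sg) q s by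
    [(1 + sg) (W - tau)]. Subtracting Y leaves
    [sg nc / 2 - (1 + sg) Y + (1 + sg) (W - tau)], in which Y and W cancel
    in mean. For the second bound, [W - tau - q Y <= q (s - Y)]. *)
Lemma sum_majorants (q D : R) (tau : nat -> R) (s e nc Y : nat -> T -> R) K :
  0 <= q < 1 -> (forall k, integ (nc k)) ->
  (forall k w, 0 <= s k w) ->
  (forall k w, nc k w <= 2 * s k w + 2 * e k w) ->
  (forall w, \sum_(k < K) (s k w - e k w) <= D) ->
  (forall k, majorant q (tau k) (s k) (e k) (Y k)) ->
  \sum_(k < K) EE (nc k)
    <= 2 * (1 + q) / (1 - q) * D + 4 / (1 - q) * \sum_(k < K) tau k
  /\ (1 - q) * \sum_(k < K) EE (Y k) <= q * D + \sum_(k < K) tau k.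
Proof.
move=> /andP[q0 q1] inc s0 nse sD maj.
have iY k : integ (Y k) by case: (maj k).
have eY k w : e k w <= Y k w by case: (maj k).
have /choice[W hW] : forall k, exists W, [/\ integ W, EE W = EE (Y k) &
    {ae P, forall w, W w <= q * s k w + tau k}] by move=> k; case: (maj k).
have iW k : integ (W k) by case: (hW k).
have EW k : EE (W k) = EE (Y k) by case: (hW k).
have hs k : {ae P, forall w, W k w <= q * s k w + tau k} by case: (hW k).
have sYD w : \sum_(k < K) (s k w - Y k w) <= D.
  by apply: le_trans (sD w); apply: ler_sum => k _; rewrite lerB.
have q1p : 0 < 1 + q by lra.
have q1n : 0 < 1 - q by lra.
split.
- pose sg := (1 - q) / (1 + q).
  have sg0 : 0 <= sg by rewrite divr_ge0// ltW.
  have sgE : sg + (1 + sg) * q = 1 by rewrite /sg; field; rewrite gt_eqF.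
  pose g k w := sg / 2 * nc k w + ((1 + sg) * (- 1) * Y k w
                + ((1 + sg) * W k w + - ((1 + sg) * tau k))).
  have ig k : integ (g k).
    apply: integrableDr; first exact: integrableZ.
    apply: integrableDr; first exact: integrableZ.
    by apply: integrableDr; [exact: integrableZ | exact: integrable_const].
  have Eg k : EE (g k) = sg / 2 * EE (nc k) - (1 + sg) * tau k.
    rewrite RintegralD//; last 2 first.
    - exact: integrableZ.
    - apply: integrableDr; first exact: integrableZ.
      by apply: integrableDr; [exact: integrableZ | exact: integrable_const].
    rewrite RintegralD//; last 2 first.
    - exact: integrableZ.
    - by apply: integrableDr; [exact: integrableZ | exact: integrable_const].
    rewrite RintegralD//; last 2 first.
    - exact: integrableZ.
    - exact: integrable_const.
    by rewrite !RintegralZl// Rintegral_const EW; ring.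
  have gh k : {ae P, forall w, g k w <= s k w - Y k w}.
    apply: filterS (hs k) => w hw; rewrite /g.
    have h1 : sg / 2 * nc k w <= sg * s k w + sg * Y k w.
      have := ler_wpM2l sg0 (nse k w); have := ler_wpM2l sg0 (eY k w); lra.
    have h2 : (1 + sg) * W k w <= (1 + sg) * (q * s k w + tau k).
      by rewrite ler_wpM2l// addr_ge0.
    have h3 : sg * s k w + (1 + sg) * q * s k w = s k w.
      by rewrite -mulrDl sgE mul1r.
    lra.
  have := sum_Rintegral_le ig gh sYD.
  under eq_bigr do rewrite Eg.
  rewrite sumrB -!mulr_sumr => h.
  set Sn := \sum_(k < K) EE (nc k) in h *.
  set St := \sum_(k < K) tau k in h *.
  rewrite -(ler_pM2l (_ : 0 < sg / 2)); last by rewrite !divr_gt0.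
  have -> : sg / 2 * (2 * (1 + q) / (1 - q) * D + 4 / (1 - q) * St)
     = D + (1 + sg) * St.
    by rewrite /sg; field; rewrite !gt_eqF.
  lra.
- pose g k w := W k w + (- q * Y k w + - tau k).
  have ig k : integ (g k).
    apply: integrableDr => //.
    by apply: integrableDr; [exact: integrableZ | exact: integrable_const].
  have Eg k : EE (g k) = (1 - q) * EE (Y k) - tau k.
    rewrite RintegralD//; last first.
      by apply: integrableDr; [exact: integrableZ | exact: integrable_const].
    rewrite RintegralD//; last 2 first.
    - exact: integrableZ.
    - exact: integrable_const.
    by rewrite !RintegralZl// Rintegral_const EW; ring.
  have gh k : {ae P, forall w, g k w <= q * (s k w - Y k w)}.
    by apply: filterS (hs k) => w hw; rewrite /g; lra.
  have qsD w : \sum_(k < K) q * (s k w - Y k w) <= q * D.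
    by rewrite -mulr_sumr ler_wpM2l.
  have := sum_Rintegral_le ig gh qsD.
  under eq_bigr do rewrite Eg.
  by rewrite sumrB -!mulr_sumr; lra.
Qed.

End Majorants.

(** * One iteration of the method *)

Section Histories.
Context d (T : measurableType d) (R : realType).
Context d' (Xi : measurableType d') (xi : nat -> T -> Xi).
Hypothesis xi_meas : forall k, measurable_fun setT (xi k).

Lemma history_setT k : history xi k setT.
Proof.
have [h0 hC _] := smallest_sigma_algebra setT
  (\big[setU/set0]_(i < k) preimage_set_system setT (xi i) measurable).
by have := hC _ h0; rewrite setD0.
Qed.

Lemma history_measurable k : history xi k `<=` measurable.
Proof.
apply: smallest_sub; first exact: sigma_algebra_measurable.
elim/big_ind : _ => [//|S1 S2 h1 h2|i _ _ [C mC <-]]; last exact: xi_meas.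
by rewrite subUset.
Qed.

Lemma measurable_wrt_history k (Y : T -> R) :
  measurable_wrt (history xi k) Y -> measurable_fun setT Y.
Proof.
by move=> hY _ B mB; apply: (@history_measurable k); apply: hY; exists B.
Qed.

End Histories.

Section Iteration.
Variables (R : realType) (m n : nat).
Variables (f : 'cV[R]_n -> R) (A : 'M[R]_(m, n)) (b : 'cV[R]_m).
Variables (X : set 'cV[R]_n) (alpha L : R).
Hypotheses (X0 : X !=set0) (cX : compact X) (vX : convex_set X).
Hypothesis vf : convex_function X (f : 'cV[R]_n -> R^o).
Hypothesis df : forall x, X x -> differentiable (f : 'cV[R]_n -> R^o) x.
Hypothesis lf : lipschitz2_on X L (grad f).
Hypothesis alpha0 : 0 < alpha.
Local Notation c := (constr A b).
Local Notation AL := (auglagr f A b alpha).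
Local Notation LC := (L + alpha * opnorm A ^+ 2).

Lemma sqr_norm2D_le k (u v : 'cV[R]_k) :
  norm2 (u + v) ^+ 2 <= 2 * norm2 u ^+ 2 + 2 * norm2 v ^+ 2.
Proof.
have := dotv_ge0 (u - v).
by rewrite !sqr_norm2 !dotv_lin (dotvC v u); lra.
Qed.

Lemma constr_bounded : exists B, forall x, X x -> norm2 (c x) ^+ 2 <= B.
Proof.
have [x0 Xx0] := X0; have [D hD] := compact_norm2_bounded x0 X0 cX.
exists (2 * (opnorm A * D) ^+ 2 + 2 * norm2 (c x0) ^+ 2) => x Xx.
have -> : c x = A *m (x - x0) + c x0 by rewrite -(constrB A b) subrK.
apply: le_trans (sqr_norm2D_le _ _) _; rewrite lerD2r ler_wpM2l//.
rewrite lerXn2r ?nnegrE ?norm2_ge0//.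
  by rewrite mulr_ge0 ?opnorm_ge0// (le_trans (norm2_ge0 _) (hD _ Xx)).
by apply: le_trans (norm2_mulmx_le _ _) _; rewrite ler_wpM2l ?opnorm_ge0// hD.
Qed.

(** Telescoped descent of the envelope, for one realization of the method with
    arbitrary inexact constraint values d. *)
Lemma sum_env_descent (u d : nat -> 'cV[R]_m) (xs : nat -> 'cV[R]_n) (q : R) K :
  (forall k, u k.+1 = u k - alpha *: d k) ->
  (forall k, is_argmin X (AL ^~ (u k)) (xs k)) ->
  (forall v, q <= negdual_env f A b X alpha v) ->
  \sum_(k < K) (norm2 (c (xs k)) ^+ 2 - norm2 (c (xs k) - d k) ^+ 2)
    <= 2 / alpha * (negdual_env f A b X alpha (u 0%N) - q).
Proof.
move=> uS xsP qP.
suff : \sum_(k < K) (norm2 (c (xs k)) ^+ 2 - norm2 (c (xs k) - d k) ^+ 2)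
  <= 2 / alpha * (negdual_env f A b X alpha (u 0%N)
                  - negdual_env f A b X alpha (u K)).
  move=> /le_trans; apply; rewrite ler_wpM2l ?divr_ge0 ?(ltW alpha0)//.
  by rewrite lerD2l lerN2.
elim: K => [|K IH]; first by rewrite big_ord0 subrr mulr0.
rewrite big_ord_recr/=.
have := env_descent X0 cX vX vf df alpha0 (d K) (xsP K); rewrite -uS.
set e := negdual_env f A b X alpha in IH *.
move=> h.
have a2 : 0 < 2 / alpha by rewrite divr_gt0.
have := ler_wpM2l (ltW a2) h.
have -> : 2 / alpha * (e (u K) - alpha / 2 * norm2 (c (xs K)) ^+ 2
                       + alpha / 2 * norm2 (c (xs K) - d K) ^+ 2)
  = 2 / alpha * e (u K) - norm2 (c (xs K)) ^+ 2 + norm2 (c (xs K) - d K) ^+ 2.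
  by field; rewrite gt_eqF.
by move: IH; rewrite !mulrBr; lra.
Qed.

(** The ordinary Lagrangian at the updated multiplier has at x the same gradient
    as the augmented Lagrangian at the old one. *)
Lemma redgrad0_redgrad eta x u : X x ->
  redgrad0 f A b X eta x (u - alpha *: c x) = redgrad f A b X alpha eta x u.
Proof.
move=> Xx; rewrite /redgrad0 /redgrad lagr_auglagr0.
rewrite !grad_auglagr; [|exact: df|exact: df].
by rewrite scale0r subr0.
Qed.

Context d (T : measurableType d) (P : probability T R).
Variables (G : set (set T)) (x xs : T -> 'cV[R]_n) (l : T -> 'cV[R]_m).
Hypotheses (GT : G setT) (Xx : forall w, X (x w)).
Hypothesis xsP : forall w, is_argmin X (AL ^~ (l w)) (xs w).
Variables (theta tau : R).
Hypothesis tau0 : 0 <= tau.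
Let s w := norm2 (c (xs w)) ^+ 2.
Let e w := norm2 (c (xs w) - c (x w)) ^+ 2.

Lemma inexact_a_majorant : inexact_a P A b G x xs theta tau ->
  exists Y, majorant P (theta ^+ 2) tau s e Y.
Proof.
move=> ha; exists (fun w => 1 * e w).
by apply: (cond_exp_le_majorant GT ler01 ha) => w; rewrite mul1r.
Qed.

(** By quadratic growth the optimality gap bounds the constraint error, and by
    the decrease of a projected gradient step it bounds the reduced gradient. *)
Lemma inexact_b_majorant : inexact_b P f A b alpha G x xs l theta tau ->
  exists2 Y, majorant P (theta ^+ 2) tau s e Y &
    forall eta w, 0 < eta -> eta * LC < 1 ->
      norm2 (redgrad f A b X alpha eta (x w) (l w)) ^+ 2
        <= (eta * (1 - eta * LC))^-1 * (alpha / 2) * Y w.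
Proof.
move=> hb.
exists (fun w => 2 / alpha * (AL (x w) (l w) - AL (xs w) (l w))).
  apply: (cond_exp_le_majorant GT _ hb) => [|w|w].
  - by rewrite divr_ge0// ltW.
  - rewrite -invf_div ler_pdivlMl ?divr_gt0//.
    exact: (auglagr_growth vX vf (xsP w) (Xx w)).
  - rewrite le_eqVlt; apply/orP; left; apply/eqP.
    by rewrite /s; field; rewrite gt_eqF.
move=> eta w eta0 etaC.
have k0 : 0 < eta * (1 - eta * LC) by rewrite mulr_gt0// subr_gt0.
rewrite -mulrA [alpha / 2 * _](_ : _ = AL (x w) (l w) - AL (xs w) (l w)).
  rewrite ler_pdivlMl//.
  exact: (redgrad_decrease X0 cX vX vf df lf alpha0 eta0 (Xx w) (xsP w)).
by field; rewrite gt_eqF.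
Qed.

Variables (mu eta_bar theta' tau' : R).

(** The factor turning the squared reduced gradient into a bound on the squared
    error in the constraint. When A = 0 that error vanishes, and any positive
    factor will do. *)
Definition error_factor : R :=
  if opnorm A == 0 then 1 else 4 * opnorm A ^+ 2 / mu ^+ 2.

Lemma error_factor_gt0 : 0 < mu -> 0 < error_factor.
Proof.
move=> mu0; rewrite /error_factor; case: eqVneq => // a0.
have ap : 0 < opnorm A by rewrite lt_neqAle eq_sym a0 opnorm_ge0.
by rewrite divr_gt0 ?exprn_gt0// mulr_gt0// exprn_gt0.
Qed.

Lemma error_factor_ge : 4 * opnorm A ^+ 2 / mu ^+ 2 <= error_factor.
Proof.
rewrite /error_factor; case: eqVneq => // ->.
by rewrite expr0n/= mulr0 mul0r.
Qed.

(** The error bound turns the reduced gradient at the step [eta_bar] into a bound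
    on the constraint error; the comparison of step sizes gives the reduced
    gradient at any other step. *)
Lemma inexact_c_majorant :
  inexact_c P f A b X alpha G x xs l L mu eta_bar theta tau theta' tau' ->
  exists2 Y, majorant P (theta ^+ 2) tau s e Y &
    forall eta w, 0 < eta -> eta * LC < 1 ->
      norm2 (redgrad f A b X alpha eta (x w) (l w)) ^+ 2
        <= (1 + eta_bar / eta) ^+ 2 / error_factor * Y w.
Proof.
move=> [[mu0 sc] [eb0 ebC] [/andP[th0 th1] thle] [ta0 tale] hc].
have C0 := error_factor_gt0 mu0.
exists (fun w => error_factor *
    norm2 (redgrad f A b X alpha eta_bar (x w) (l w)) ^+ 2).
  apply: (cond_exp_le_majorant GT (ltW C0) hc) => w.
    apply: le_trans (ler_wpM2r (sqr_ge0 _) error_factor_ge).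
    have h := redgrad_error_bound X0 cX vX vf df lf alpha0 mu0 (sc (l w)) eb0
      ebC (Xx w) (xsP w).
    rewrite /e constrB.
    apply: le_trans (_ : (opnorm A * norm2 (xs w - x w)) ^+ 2 <= _).
      by rewrite lerXn2r ?nnegrE ?mulr_ge0 ?norm2_ge0 ?opnorm_ge0 ?norm2_mulmx_le.
    set r := norm2 (redgrad _ _ _ _ _ _ _ _) in h *.
    have -> : 4 * opnorm A ^+ 2 / mu ^+ 2 * r ^+ 2 = (opnorm A * (2 / mu * r)) ^+ 2.
      by field; rewrite gt_eqF.
    rewrite lerXn2r ?nnegrE ?mulr_ge0 ?norm2_ge0 ?opnorm_ge0// ?invr_ge0 ?(ltW mu0)//.
    by rewrite ler_wpM2l ?opnorm_ge0.
  have [ht htau] : error_factor * theta' ^+ 2 <= theta ^+ 2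
      /\ error_factor * tau' <= tau.
    rewrite /error_factor; case: eqVneq thle tale => [->|a0] thle tale.
      move: thle tale; rewrite expr0n/= !mulr0 !invr0 !mulr0 => thle tale.
      have -> : theta' = 0 by apply/eqP; rewrite eq_le thle th0.
      have -> : tau' = 0 by apply/eqP; rewrite eq_le tale ta0.
      by rewrite expr0n/= !mulr0 sqr_ge0.
    have ap : 0 < opnorm A by rewrite lt_neqAle eq_sym a0 opnorm_ge0.
    have Cp : 0 < 4 * opnorm A ^+ 2 / mu ^+ 2.
      by rewrite divr_gt0 ?exprn_gt0// mulr_gt0// exprn_gt0.
    split; rewrite -ler_pdivlMl//.
      have -> : (4 * opnorm A ^+ 2 / mu ^+ 2)^-1 * theta ^+ 2
          = (mu * theta / (2 * opnorm A)) ^+ 2.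
        by field; rewrite a0 gt_eqF.
      by rewrite lerXn2r ?nnegrE// (le_trans th0).
    have -> : (4 * opnorm A ^+ 2 / mu ^+ 2)^-1 * tau
        = mu ^+ 2 * tau / (4 * opnorm A ^+ 2) by field; rewrite a0 gt_eqF.
    exact: tale.
  rewrite mulrDr lerD// mulrA /s ler_wpM2r ?sqr_ge0//.
move=> eta w eta0 etaC.
rewrite mulrA divfK ?gt_eqF// -exprMn lerXn2r ?nnegrE ?norm2_ge0//.
  by rewrite mulr_ge0 ?norm2_ge0// addr_ge0// divr_ge0 ?ltW.
exact: projgrad_step_le.
Qed.

End Iteration.

(** * Convergence of the method *)

Lemma constr_sqr_integrable (R : realType) (m n : nat) (A : 'M[R]_(m, n))
    (b : 'cV[R]_m) (X : set 'cV[R]_n) d (T : measurableType d)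
    (P : probability T R) (x : T -> 'cV[R]_n) :
  X !=set0 -> compact X -> (forall w, X (x w)) ->
  (forall i, measurable_fun setT (fun w => x w i 0)) ->
  P.-integrable setT (EFin \o (fun w => norm2 (constr A b (x w)) ^+ 2)).
Proof.
move=> X0 cX Xx mx; have [B hB] := constr_bounded A b X0 cX.
apply: measurable_bounded_integrable => //.
- by rewrite (le_lt_trans (probability_le1 _ _)) ?ltry.
- have -> : (fun w => norm2 (constr A b (x w)) ^+ 2) =
    (fun w => \sum_i (\sum_j A i j * x w j 0 - b i 0) ^+ 2).
    apply/funext => w; rewrite sqr_norm2; apply: eq_bigr => i _.
    by rewrite !mxE expr2.
  apply: measurable_sum => i; apply: measurable_funX.
  apply: measurable_funB => //; apply: measurable_sum => j.
  exact: measurable_funM.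
- exists B; split; first exact: num_real.
  move=> M BM w _ /=; rewrite ger0_norm ?sqr_ge0//.
  exact: le_trans (hB _ (Xx w)) (ltW BM).
Qed.

Theorem theorem4p2 (R : realType) (m n : nat)
  (* the problem: f = E[F(., zeta)], X, and c(x) = A x - b *)
  (dz : measure_display) (Z : measurableType dz) (Q : probability Z R)
  (F : 'cV[R]_n -> Z -> R) (f : 'cV[R]_n -> R)
  (X : set 'cV[R]_n) (A : 'M[R]_(m, n)) (b : 'cV[R]_m)
  (L omega1 omega2 : R)
  (F_smooth : forall z, (forall x, differentiable (F ^~ z : 'cV[R]_n -> R^o) x)
                        /\ continuous (grad (F ^~ z)))
  (F_int : forall x, Q.-integrable setT (EFin \o F x))
  (f_def : forall x, (f x)%:E = 'E_Q[F x]%E)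
  (X_neq0 : X !=set0) (X_convex : convex_set X) (X_compact : compact X)
  (f_convex : convex_function X (f : 'cV[R]_n -> R^o))
  (f_diff : forall x, X x -> differentiable (f : 'cV[R]_n -> R^o) x)
  (f_C1 : {within X, continuous (grad f)})
  (L_ge0 : 0 <= L) (f_lip : lipschitz2_on X L (grad f))
  (kkt : exists (xs : 'cV[R]_n) (ls : 'cV[R]_m) (eta : R),
     [/\ X xs, constr A b xs = 0, 0 < eta & redgrad0 f A b X eta xs ls = 0])
  (omega_ge0 : 0 <= omega1 /\ 0 <= omega2)
  (F_var : forall x, X x ->
     ('E_Q[fun z => (norm2 (grad (F ^~ z) x - grad f x) ^+ 2)%R]
        <= (omega1 * norm2 (grad f x) ^+ 2 + omega2)%:E)%E)
  (* the method *)
  (xinit : 'cV[R]_n) (l0 : 'cV[R]_m) (alpha : R) (alpha_gt0 : 0 < alpha)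
  (d : measure_display) (T : measurableType d) (P : probability T R)
  (dxi : measure_display) (Xi : measurableType dxi) (xi : nat -> T -> Xi)
  (xi_meas : forall k, measurable_fun setT (xi k))
  (solver : nat -> 'cV[R]_n -> 'cV[R]_m -> Xi -> 'cV[R]_n) :
  let x := ialm_x A b alpha xinit l0 solver xi in
  let l := ialm_l A b alpha xinit l0 solver xi in
  let c := constr A b in
  let Fk := history xi in
  forall
  (x_meas : forall k i, measurable_wrt (Fk k.+1) (fun w => x k w i 0))
  (x_in : forall k w, X (x k w))
  (xstar : nat -> T -> 'cV[R]_n)
  (xstar_min : forall k w,
     is_argmin X (auglagr f A b alpha ^~ (l k w)) (xstar k w))
  (* the inexactness conditions *)
  (theta : R) (theta_itv : 0 <= theta < 1)
  (tau : nat -> R) (tau_ge0 : forall k, 0 <= tau k) (tau0_gt0 : 0 < tau 0%N)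
  (ainf : R)
  (tau_sum : (fun N : nat => (tau 0%N)^-1 * \sum_(k < N) tau k) @ \oo --> ainf)
  (mu eta_bar theta' : R) (tau' : nat -> R),
  let cond_a k := inexact_a P A b (Fk k) (x k) (xstar k) theta (tau k) in
  let cond_b k :=
    inexact_b P f A b alpha (Fk k) (x k) (xstar k) (l k) theta (tau k) in
  let cond_c k :=
    inexact_c P f A b X alpha (Fk k) (x k) (xstar k) (l k)
      L mu eta_bar theta (tau k) theta' (tau' k) in
  forall (inexact : forall k, [\/ cond_a k, cond_b k | cond_c k]),
  let Ec k := 'E_P[fun w => (norm2 (c (x k w)) ^+ 2)%R]%E in
  [/\ Ec k @[k --> \oo] --> 0%E,
      (exists2 qstar : R,
         is_minimum (range (negdual_env f A b X alpha)) qstar &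
         forall K : nat, (0 < K)%N ->
           (\big[Order.min/+oo]_(k < K) Ec k <=
             (4 * (1 + theta ^+ 2) / (alpha * (1 - theta ^+ 2) * K%:R)
                * (negdual_env f A b X alpha l0 - qstar)
              + 4 / (1 - theta ^+ 2) * (tau 0%N * ainf / K%:R))%:E)%E) &
      (forall k, cond_b k \/ cond_c k) ->
      forall eta : R, 0 < eta -> eta * (L + alpha * opnorm A ^+ 2) < 1 ->
        'E_P[fun w => (norm2 (redgrad0 f A b X eta (x k w) (l k.+1 w)) ^+ 2)%R]%E
          @[k --> \oo] --> 0%E].
Proof.
move=> x l c Fk x_meas x_in xstar xstar_min theta /andP[th0 th1] tau tau_ge0
  tau0_gt0 ainf tau_sum mu eta_bar theta' tau' cond_a cond_b cond_c inexact Ec.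
have [xs [ls [eta0 [Xxs cxs eta0_gt0 r0]]]] := kkt.
have saddle := kkt_argmin X_neq0 X_compact X_convex f_convex f_diff
  eta0_gt0 Xxs r0.
have qmin := env_minimum X_neq0 X_compact f_convex f_diff alpha_gt0 saddle cxs.
set env := negdual_env f A b X alpha in qmin *.
pose q := theta ^+ 2; have q01 : 0 <= q < 1 by rewrite sqr_ge0/= expr_lt1.
have /andP[q0 q1] := q01; have q1n : 0 < 1 - q by rewrite subr_gt0.
pose s k w := norm2 (c (xstar k w)) ^+ 2.
pose e k w := norm2 (c (xstar k w) - c (x k w)) ^+ 2.
pose nc k w := norm2 (c (x k w)) ^+ 2.
have nc_int k : P.-integrable setT (EFin \o nc k).
  apply: (constr_sqr_integrable _ _ _ X_neq0 X_compact) => // i.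
  by have := measurable_wrt_history xi_meas (x_meas k i).
have s_ge0 k w : 0 <= s k w by exact: sqr_ge0.
have nse k w : nc k w <= 2 * s k w + 2 * e k w.
  rewrite /nc /s /e.
  have := sqr_norm2D_le (c (xstar k w)) (- (c (xstar k w) - c (x k w))).
  by rewrite norm2N opprB addrC subrK.
pose D := 2 / alpha * (env l0 - - f xs).
have sD K w : \sum_(k < K) (s k w - e k w) <= D.
  apply: (@sum_env_descent _ _ _ f A b X alpha X_neq0 X_compact X_convex
    f_convex f_diff alpha_gt0 (l ^~ w) (fun k => c (x k w)) (xstar ^~ w)) => //.
  by move=> v; apply: qmin.2; exists v.
have FT k : Fk k setT by exact: history_setT.
have tauS K : \sum_(k < K) tau k <= tau 0%N * ainf.
  rewrite -ler_pdivrMl//.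
  have nd : {homo (fun N : nat => (tau 0%N)^-1 * \sum_(k < N) tau k) :
      i j / (i <= j)%N >-> i <= j}.
    apply/nondecreasing_seqP => N; rewrite big_ord_recr/=.
    by rewrite ler_wpM2l ?invr_ge0 ?(ltW tau0_gt0)// lerDl.
  have := nondecreasing_cvgn_le nd (cvgP _ tau_sum) K.
  by rewrite (cvg_lim _ tau_sum).
have maj k : exists Y, majorant P q (tau k) (s k) (e k) Y.
  have [ha|hb|hc] := inexact k.
  - exact: (inexact_a_majorant (FT k) ha).
  - by have [Y hY _] := inexact_b_majorant X_neq0 X_compact X_convex f_convex
      f_diff f_lip alpha_gt0 (FT k) (x_in k) (xstar_min k) hb; exists Y.
  - by have [Y hY _] := inexact_c_majorant X_neq0 X_compact X_convex f_convex
      f_diff f_lip alpha_gt0 (FT k) (x_in k) (xstar_min k) (tau_ge0 k) hc; exists Y.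
have EcE k : Ec k = (Rintegral P setT (nc k))%:E.
  exact: (expectation_Rintegral (nc_int k)).
have nc_ge0 k : 0 <= Rintegral P setT (nc k).
  by apply: Rintegral_ge0 => w _; exact: sqr_ge0.
pose B := 2 * (1 + q) / (1 - q) * D + 4 / (1 - q) * (tau 0%N * ainf).
have ncB K : \sum_(k < K) Rintegral P setT (nc k) <= B.
  have /choice[Y hY] := maj.
  have [h _] := sum_majorants q01 nc_int s_ge0 nse (sD K) hY.
  apply: (le_trans h); rewrite lerD2l ler_wpM2l//.
  by rewrite divr_ge0// ltW.
split.
- under eq_fun do rewrite EcE.
  by apply: cvg_EFin; [exact: nearW|exact: bounded_series_cvg0 nc_ge0 ncB].
- exists (- f xs) => // K K0.
  have Kp : 0 < K%:R :> R by rewrite ltr0n.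
  rewrite [X in (_ <= X%:E)%E](_ : _ = B / K%:R); last first.
    by rewrite /B /D /q; field; rewrite !gt_eqF.
  (* otherwise every term exceeds B / K and the sum exceeds B *)
  apply/bigmin_leP; right.
  apply: contrapT => hno; have := ncB K.
  apply/negP; rewrite -ltNge.
  have -> : B = \sum_(k < K) (B / K%:R).
    by rewrite sumr_const card_ord -(mulr_natr (B / K%:R)) divfK ?gt_eqF.
  apply: ltr_sum; first by apply/hasP; exists (Ordinal K0); rewrite ?mem_index_enum.
  move=> k _; rewrite ltNge; apply/negP => hk; apply: hno.
  by exists k => //; rewrite EcE lee_fin.
- move=> hbc eta eta_gt0 etaC.
  pose LC := L + alpha * opnorm A ^+ 2.
  pose kb := (eta * (1 - eta * LC))^-1 * (alpha / 2).
  pose kc := (1 + eta_bar / eta) ^+ 2 / error_factor A mu.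
  have kb0 : 0 <= kb.
    by rewrite mulr_ge0 ?divr_ge0 ?invr_ge0 ?mulr_ge0 ?subr_ge0 ?ltW.
  have kc0 : 0 <= kc.
    rewrite mulr_ge0 ?sqr_ge0// invr_ge0 /error_factor.
    by case: ifP => // _; rewrite divr_ge0 ?sqr_ge0// mulr_ge0 ?sqr_ge0.
  (* kb and kc serve the two conditions; their sum is a factor uniform in k *)
  have maj2 k : exists Y, majorant P q (tau k) (s k) (e k) Y /\
      forall w, norm2 (redgrad f A b X alpha eta (x k w) (l k w)) ^+ 2
        <= (kb + kc) * Y w.
    have Y_ge0 Y w : majorant P q (tau k) (s k) (e k) Y -> 0 <= Y w.
      by case=> _ eY _; apply: le_trans (eY w); exact: sqr_ge0.
    have [hb|hc] := hbc k.
    + have [Y hY rY] := inexact_b_majorant X_neq0 X_compact X_convex f_convex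
        f_diff f_lip alpha_gt0 (FT k) (x_in k) (xstar_min k) hb.
      exists Y; split=> // w; apply: le_trans (rY eta w eta_gt0 etaC) _.
      by rewrite ler_wpM2r ?Y_ge0// lerDl.
    + have [Y hY rY] := inexact_c_majorant X_neq0 X_compact X_convex f_convex
        f_diff f_lip alpha_gt0 (FT k) (x_in k) (xstar_min k) (tau_ge0 k) hc.
      exists Y; split=> // w; apply: le_trans (rY eta w eta_gt0 etaC) _.
      by rewrite ler_wpM2r ?Y_ge0// lerDr.
  have /choice[Y hY] := maj2.
  have hmaj k : majorant P q (tau k) (s k) (e k) (Y k) by case: (hY k).
  have iY k : P.-integrable setT (EFin \o Y k) by case: (hmaj k).
  have EY_ge0 k : 0 <= Rintegral P setT (Y k).
    apply: Rintegral_ge0 => w _; case: (hmaj k) => _ eY _.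
    by apply: le_trans (eY w); exact: sqr_ge0.
  have EYB K : \sum_(k < K) Rintegral P setT (Y k)
      <= (1 - q)^-1 * (q * D + tau 0%N * ainf).
    have [_ h] := sum_majorants q01 nc_int s_ge0 nse (sD K) hmaj.
    by rewrite ler_pdivlMl// (le_trans h)// lerD2l.
  have EY0 := bounded_series_cvg0 EY_ge0 EYB.
  apply: (@squeeze_cvge _ _ _ _ (fun=> 0%E) _
    (fun k => ((kb + kc) * Rintegral P setT (Y k))%:E)).
  + apply: nearW => k; rewrite unlock; apply/andP; split.
      by apply: integral_ge0 => w _; rewrite lee_fin sqr_ge0.
    rewrite -RintegralZl// -expectation_Rintegral; last exact: integrableZ.
    rewrite unlock; apply: ge0_le_integral_nonmeas => w; rewrite lee_fin ?sqr_ge0//.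
    rewrite (_ : l k.+1 w = l k w - alpha *: c (x k w))//.
    by rewrite redgrad0_redgrad//; case: (hY k).
  + exact: cvg_cst.
  + apply: cvg_EFin; first exact: nearW.
    rewrite -(mulr0 (kb + kc)); exact: cvgMr.
Qed.
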